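(* Let $R$ be a local ring, $V$ a valuation domain, and $\phi\colon R\to V$ a local morphism whose kernel is a minimal prime ideal of $R$. Let $\phi^{h}\colon R\to R^{h}$ be the henselisation of $R$ as a local ring, and let $V^{H}$ be the henselisation of $V$ as a valuation domain, with canonical morphism $\phi^{H}\colon V\to V^{H}$. Let $\psi\colon R^{h}\to V^{H}$ be the canonical local morphism, i.e. the unique local morphism such that $\psi\circ\phi^{h}=\phi^{H}\circ\phi$. Then the kernel of $\psi$ is a minimal prime ideal of $R^{h}$.
   Context: All rings are commutative with unit. The definitions are chosen so that they make sense constructively; classically they are equivalent to the usual ones. A discrete field is a nontrivial ring in which every element is zero or invertible. A local ring is a nontrivial ring $R$ such that $x+y\in R^\times$ implies $x\in R^\times$ or $y\in R^\times$; its maximal ideal is $\mathfrak m_R=\{x: 1+xR\subseteq R^\times\}$ and its residue field is $K_R=R/\mathfrak m_R$. $R$ is residually discrete if $K_R$ is a discrete field (automatic in classical logic); local rings considered here, in particular $R$ and $V$, are assumed residually discrete. A ring morphism $\phi\colon R\to A$ between local rings is local if $\phi(x)\in A^\times$ implies $x\in R^\times$. A ring is zero-dimensional if for each element $x$ there are an element $y$ and an integer $N\ge 0$ with $x^N(1+xy)=0$. A prime ideal $\mathfrak p$ of a ring $R$ is minimal if the localisation $R_{\mathfrak p}$ is zero-dimensional (classically: $\mathfrak p$ is minimal among prime ideals). A subring $V$ of a discrete field $K$ is a valuation ring for $K$ if every $x\in K^\times$ satisfies $x\in V$ or $x^{-1}\in V$; the pair $(K,V)$ is then called a valuated discrete field.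 A valuation domain $V$ is a valuation ring for its field of fractions $K$. Henselian local rings: a Nagata polynomial over a local ring $R$ is a monic polynomial $f=X^n+a_{n-1}X^{n-1}+\dots+a_1X+a_0\in R[X]$ with $a_1\in R^\times$ and $a_0\in\mathfrak m_R$. A henselian zero of $f$ is an $\alpha\in\mathfrak m_R$ with $f(\alpha)=0$ (there is at most one). $R$ is henselian if every Nagata polynomial over $R$ has a henselian zero. A henselisation of $R$ is a henselian local ring $R^{h}$ with a local morphism $\phi^{h}\colon R\to R^{h}$ through which every local morphism from $R$ to a henselian local ring factors uniquely via a local morphism. It exists and is unique up to unique isomorphism. Henselisation of a valuation domain: an extension of a valuated discrete field $(K,V)$ is a valuated discrete field $(L,W)$ together with a morphism $\varphi\colon K\to L$ such that $V=\varphi^{-1}(W)$. $(K,V)$ is henselian if $V$ is henselian as a local ring. A henselisation of $(K,V)$ is a henselian extension $(K^{H},V^{H})$, given by $\phi^{H}\colon K\to K^{H}$, through which every extension of $(K,V)$ to a henselian valuated discrete field factors uniquely. It exists and is unique up to unique isomorphism. The ring $V^{H}$ is the henselisation of $V$ as a valuation domain, and $\phi^{H}$ restricts to a local morphism $V\to V^{H}$. Since $V^{H}$ is henselian, the universal property of $R^{h}$ applied to $\phi^{H}\circ\phi\colon R\to V^{H}$ gives the canonical local morphism $\psi$. *)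

(* Defs.v *)
From HB Require Import structures.
From mathcomp Require Import all_boot all_order all_algebra.
From mathcomp Require Import ring_quotient generic_quotient.
From mathcomp Require Import boolp.
From mathcomp Require Import ring.

Set Implicit Arguments.
Unset Strict Implicit.
Unset Printing Implicit Defensive.

Import GRing.Theory.
Local Open Scope ring_scope.
Local Open Scope quotient_scope.

(* The localisation S^-1 R at a multiplicative subset S: fractions x / s with
   s \in S, where x / s = y / t iff u (x t - y s) = 0 for some u \in S.  If
   0 \in S this is the trivial ring, so it is only a comPzRingType.  The quotient
   needs a boolean relation, obtained from classical logic. *)
Section Localisation.
Variables (R : comNzRingType) (S : mulrClosed R).

Record fracpair := FracPair { fp_val :> R * R; _ : fp_val.2 \in S }.
HB.instance Definition _ := [isSub for fp_val].
HB.instance Definition _ := [Choice of fracpair by <:].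
Implicit Types x y z : fracpair.

Lemma fp_denP x : x.2 \in S. Proof. by case: x. Qed.

Definition loc_equiv x y : bool :=
  `[< exists2 u, u \in S & u * (x.1 * y.2 - y.1 * x.2) = 0 >].

Lemma loc_equiv_refl : reflexive loc_equiv.
Proof.
by move=> x; apply/asboolP; exists 1; rewrite ?rpred1 // subrr mulr0.
Qed.

Lemma loc_equiv_sym : symmetric loc_equiv.
Proof.
by move=> x y; apply/asboolP/asboolP => -[u uS e]; exists u => //;
  rewrite -opprB mulrN e oppr0.
Qed.

Lemma loc_equiv_trans : transitive loc_equiv.
Proof.
move=> y x z /asboolP[u uS e] /asboolP[v vS f]; apply/asboolP.
exists (u * v * y.2); first by rewrite !rpredM ?fp_denP.
suff -> : u * v * y.2 * (x.1 * z.2 - z.1 * x.2) =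
    v * z.2 * (u * (x.1 * y.2 - y.1 * x.2)) +
    u * x.2 * (v * (y.1 * z.2 - z.1 * y.2)) by rewrite e f !mulr0 addr0.
ring.
Qed.

Canonical loc_equiv_equiv :=
  EquivRel loc_equiv loc_equiv_refl loc_equiv_sym loc_equiv_trans.

Definition localisation := {eq_quot loc_equiv}.
HB.instance Definition _ : EqQuotient _ loc_equiv localisation :=
  EqQuotient.on localisation.
HB.instance Definition _ := Choice.on localisation.

Lemma loc_eqP x y :
  reflect (exists2 u, u \in S & u * (x.1 * y.2 - y.1 * x.2) = 0)
    (x == y %[mod localisation]).
Proof. by rewrite eqmodE; exact: asboolP. Qed.

Lemma loc_reprP x : exists2 u, u \in S &
  u * ((repr (\pi_localisation x)).1 * x.2
       - x.1 * (repr (\pi_localisation x)).2) = 0.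
Proof. by apply/loc_eqP; rewrite reprK. Qed.

Definition fp0 := @FracPair (0, 1) (rpred1 S).
Definition fp1 := @FracPair (1, 1) (rpred1 S).
Definition fp_add x y := @FracPair (x.1 * y.2 + y.1 * x.2, x.2 * y.2)
  (rpredM (fp_denP x) (fp_denP y)).
Definition fp_opp x := @FracPair (- x.1, x.2) (fp_denP x).
Definition fp_mul x y := @FracPair (x.1 * y.1, x.2 * y.2)
  (rpredM (fp_denP x) (fp_denP y)).

Definition loc0 : localisation := lift_cst localisation fp0.
Definition loc1 : localisation := lift_cst localisation fp1.
Definition loc_add := lift_op2 localisation fp_add.
Definition loc_opp := lift_op1 localisation fp_opp.
Definition loc_mul := lift_op2 localisation fp_mul.

Canonical pi_loc0_morph := PiConst loc0.
Canonical pi_loc1_morph := PiConst loc1.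

Lemma pi_loc_add : {morph \pi : x y / fp_add x y >-> loc_add x y}.
Proof.
move=> x y; unlock loc_add; apply/eqP/loc_eqP => /=.
have [u uS e] := loc_reprP x; have [v vS f] := loc_reprP y.
move: (repr _) (repr _) e f => y' x' e f.
exists (u * v); first by rewrite rpredM.
transitivity (- (v * y.2 * y'.2 * (u * (x'.1 * x.2 - x.1 * x'.2)) +
    u * x.2 * x'.2 * (v * (y'.1 * y.2 - y.1 * y'.2)))); first by ring.
by rewrite e f !mulr0 addr0 oppr0.
Qed.
Canonical pi_loc_add_morph := PiMorph2 pi_loc_add.

Lemma pi_loc_opp : {morph \pi : x / fp_opp x >-> loc_opp x}.
Proof.
move=> x; unlock loc_opp; apply/eqP/loc_eqP => /=.
have [u uS e] := loc_reprP x; move: (repr _) e => x' e.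
exists u => //; rewrite -[RHS]e; ring.
Qed.
Canonical pi_loc_opp_morph := PiMorph1 pi_loc_opp.

Lemma pi_loc_mul : {morph \pi : x y / fp_mul x y >-> loc_mul x y}.
Proof.
move=> x y; unlock loc_mul; apply/eqP/loc_eqP => /=.
have [u uS e] := loc_reprP x; have [v vS f] := loc_reprP y.
move: (repr _) (repr _) e f => y' x' e f.
exists (u * v); first by rewrite rpredM.
transitivity (- (v * y.2 * y'.1 * (u * (x'.1 * x.2 - x.1 * x'.2)) +
    u * x.1 * x'.2 * (v * (y'.1 * y.2 - y.1 * y'.2)))); first by ring.
by rewrite e f !mulr0 addr0 oppr0.
Qed.
Canonical pi_loc_mul_morph := PiMorph2 pi_loc_mul.

Lemma loc_pi_eq x y : x.1 * y.2 = y.1 * x.2 -> \pi_localisation x = \pi y.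
Proof.
move=> e; apply/eqP/loc_eqP.
by exists 1; rewrite ?rpred1 // e subrr mulr0.
Qed.

Lemma loc_addA : associative loc_add.
Proof.
elim/quotW=> x; elim/quotW=> y; elim/quotW=> z; rewrite !piE.
apply: loc_pi_eq => /=; ring.
Qed.

Lemma loc_addC : commutative loc_add.
Proof.
elim/quotW=> x; elim/quotW=> y; rewrite !piE; apply: loc_pi_eq => /=; ring.
Qed.

Lemma loc_add0 : left_id loc0 loc_add.
Proof. elim/quotW=> x; rewrite !piE; apply: loc_pi_eq => /=; ring. Qed.

Lemma loc_addN : left_inverse loc0 loc_opp loc_add.
Proof. elim/quotW=> x; rewrite !piE; apply: loc_pi_eq => /=; ring. Qed.

HB.instance Definition _ :=
  GRing.isZmodule.Build localisation loc_addA loc_addC loc_add0 loc_addN.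

Lemma loc_mulA : associative loc_mul.
Proof.
elim/quotW=> x; elim/quotW=> y; elim/quotW=> z; rewrite !piE.
apply: loc_pi_eq => /=; ring.
Qed.

Lemma loc_mulC : commutative loc_mul.
Proof.
elim/quotW=> x; elim/quotW=> y; rewrite !piE; apply: loc_pi_eq => /=; ring.
Qed.

Lemma loc_mul1 : left_id loc1 loc_mul.
Proof. elim/quotW=> x; rewrite !piE; apply: loc_pi_eq => /=; ring. Qed.

Lemma loc_mulDl : left_distributive loc_mul loc_add.
Proof.
elim/quotW=> x; elim/quotW=> y; elim/quotW=> z; rewrite !piE.
apply: loc_pi_eq => /=; ring.
Qed.

HB.instance Definition _ := GRing.Zmodule_isComPzRing.Build localisation
  loc_mulA loc_mulC loc_mul1 loc_mulDl.

End Localisation.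

Section PrimeComplement.
Variables (R : comNzRingType) (p : prime_idealr R).

Definition prime_compl : {pred R} := [pred x | x \notin p].

Fact prime_compl_mulr_closed : mulr_closed prime_compl.
Proof.
split=> [|x y]; rewrite !inE ?idealr1 //.
by rewrite prime_idealrM negb_or => -> ->.
Qed.
HB.instance Definition _ :=
  GRing.isMulClosed.Build R prime_compl prime_compl_mulr_closed.

End PrimeComplement.

Definition zero_dimensional (A : comPzRingType) : Prop :=
  forall x : A, exists (y : A) (N : nat), x ^+ N * (1 + x * y) = 0.

Definition minimal_prime (R : comNzRingType) (p : prime_idealr R) : Prop :=
  zero_dimensional (localisation (prime_compl p)).

Section Kernel.
Variables (R : comNzRingType) (A : idomainType) (f : {rmorphism R -> A}).

Definition rker : {pred R} := [pred x | f x == 0].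

Fact rker_idealr : idealr_closed rker.
Proof.
split=> [||a x y]; rewrite !inE ?rmorph0 ?rmorph1 ?oner_eq0 //.
by move=> /eqP fx /eqP fy; rewrite rmorphD rmorphM fx fy mulr0 addr0.
Qed.
HB.instance Definition _ := isIdealr.Build R rker rker_idealr.

Fact rker_prime : prime_idealr_closed rker.
Proof. by move=> x y; rewrite !inE rmorphM mulf_eq0. Qed.
HB.instance Definition _ := isPrimeIdealrClosed.Build R rker rker_prime.

End Kernel.

Definition maximal_ideal (R : comUnitRingType) (x : R) : Prop :=
  forall y : R, 1 + x * y \is a GRing.unit.

Definition local_ring (R : comUnitRingType) : Prop :=
  forall x y : R, x + y \is a GRing.unit ->
    x \is a GRing.unit \/ y \is a GRing.unit.

(* Every element of the residue field R / m is zero or invertible; an x : R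
   invertible modulo the maximal ideal m is already invertible in R. *)
Definition residually_discrete (R : comUnitRingType) : Prop :=
  forall x : R, maximal_ideal x \/ x \is a GRing.unit.

(* Invertibility is decidable in a comUnitRingType, so residual discreteness,
   which is assumed of all local rings below, need not be a hypothesis. *)
Lemma local_residually_discrete (R : comUnitRingType) :
  local_ring R -> residually_discrete R.
Proof.
move=> locR x; case: (boolP (x \is a GRing.unit)) => xU; [by right | left => y].
case: (locR (1 + x * y) (- (x * y))); rewrite ?addrK ?unitr1 //.
by rewrite unitrN unitrM (negPf xU).
Qed.

Definition local_morphism (R A : comUnitRingType) (f : {rmorphism R -> A}) :
    Prop :=
  forall x : R, f x \is a GRing.unit -> x \is a GRing.unit.

Definition nagata (R : comUnitRingType) (f : {poly R}) : Prop :=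
  [/\ f \is monic, f`_1 \is a GRing.unit & maximal_ideal f`_0].

Definition henselian_zero (R : comUnitRingType) (f : {poly R}) (a : R) : Prop :=
  maximal_ideal a /\ root f a.

Definition henselian (R : comUnitRingType) : Prop :=
  local_ring R /\
  forall f : {poly R}, nagata f -> exists a : R, henselian_zero f a.

Definition is_henselisation (R Rh : comUnitRingType)
    (phih : {rmorphism R -> Rh}) : Prop :=
  [/\ henselian Rh, local_morphism phih &
    forall (A : comUnitRingType) (f : {rmorphism R -> A}),
      henselian A -> local_morphism f ->
      exists g : {rmorphism Rh -> A},
        [/\ local_morphism g, g \o phih =1 f &
          forall g' : {rmorphism Rh -> A},
            local_morphism g' -> g' \o phih =1 f -> g' =1 g]].

(* A subring of a field K is presented as an integral domain V with an
   injective morphism i : V -> K; the subring proper is the image of i. *)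
Definition valuated_field (K : fieldType) (V : idomainType)
    (i : {rmorphism V -> K}) : Prop :=
  injective i /\
  forall x : K, x != 0 -> (exists v, i v = x) \/ (exists v, i v = x^-1).

Definition valuation_domain (V : idomainType) : Prop :=
  valuated_field (@FracField.tofrac V : {rmorphism V -> {fraction V}}).

(* f : K -> L satisfies V = f^-1 (W), for V and W embedded by i and j. *)
Definition val_extension (K L : fieldType) (V W : idomainType)
    (i : {rmorphism V -> K}) (j : {rmorphism W -> L}) (f : {rmorphism K -> L}) :
    Prop :=
  forall x : K, (exists v, i v = x) <-> (exists w, j w = f x).

Definition is_val_henselisation (K KH : fieldType) (V VH : idomainType)
    (i : {rmorphism V -> K}) (iH : {rmorphism VH -> KH})
    (phiH : {rmorphism K -> KH}) : Prop :=
  [/\ valuated_field iH, henselian VH, val_extension i iH phiH &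
    forall (L : fieldType) (W : idomainType) (j : {rmorphism W -> L})
        (f : {rmorphism K -> L}),
      valuated_field j -> henselian W -> val_extension i j f ->
      exists g : {rmorphism KH -> L},
        [/\ val_extension iH j g, g \o phiH =1 f &
          forall g' : {rmorphism KH -> L},
            val_extension iH j g' -> g' \o phiH =1 f -> g' =1 g]].

(* Main.v *)
(** Let p = ker phi, q = ker psi and S = R \ p; then phih^-1(q) = p.  Minimality
    of p says that every element of p is killed, up to a power, by an element of
    S.  The elements x of R^h such that s x is integral over R for some s in S
    form a subring stable under inverses of units and under roots of monic
    polynomials; such a subring is henselian, so it is all of R^h by the
    universal property.  Hence each x in q is a root of some F in R[X] with a
    coefficient outside p.  The coefficients in p below the first one outside p
    are S-torsion up to nilpotents, so t (x^m G(x))^N = 0 for some t in S and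
    some G in R[X] with G(0) not in p.  Since x is in q and G(0) is not in p, G(x) is
    not in q: thus x^(mN) is killed by t G(x)^N, which is outside q. *)

Require Import Defs.
From HB Require Import structures.
From mathcomp Require Import all_boot all_order all_algebra.
From mathcomp Require Import ring_quotient generic_quotient.
From mathcomp Require Import boolp.
From mathcomp Require Import ring.

Set Implicit Arguments.
Unset Strict Implicit.
Unset Printing Implicit Defensive.

Import GRing.Theory.
Local Open Scope ring_scope.

(** * Subrings of a henselian ring closed under inverses of units *)

Section DivringSubType.
Variables (B : comUnitRingType) (S : divringClosed B).

Record divring_sub := DivringSub { divring_val :> B; _ : divring_val \in S }.
HB.instance Definition _ := [isSub for divring_val].
HB.instance Definition _ := [Choice of divring_sub by <:].
HB.instance Definition _ := [SubChoice_isSubComUnitRing of divring_sub by <:].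

(** A unit of [B] lying in [S] has its inverse in [S], so the inclusion into [B] is a local
    morphism. *)
Lemma divring_sub_unitE (x : divring_sub) :
  (x \is a GRing.unit) = (val x \is a GRing.unit).
Proof. by []. Qed.

Lemma divring_sub_local : local_ring B -> local_ring divring_sub.
Proof.
move=> locB x y; rewrite !divring_sub_unitE rmorphD; exact: locB.
Qed.

(** If [val x] were a unit, [- x^-1] would lie in the subring and [1 + x * (- x^-1) = 0] would be a
    unit; otherwise residual discreteness of [B] applies. *)
Lemma divring_sub_maximal (x : divring_sub) :
  local_ring B -> maximal_ideal x <-> maximal_ideal (val x).
Proof.
move=> locB; split=> [mx | mx y]; last first.
  by rewrite divring_sub_unitE rmorphD rmorph1 rmorphM.
case: (local_residually_discrete locB (val x)) => // xU.
by have:= mx (- x^-1); rewrite mulrN mulrV // subrr unitr0.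
Qed.

(** A henselian zero found in [B] is a root of a monic polynomial over [S], hence lies in [S]. *)
Lemma divring_sub_henselian :
    henselian B ->
    (forall (F : {poly B}) a,
      F \is monic -> F \is a polyOver S -> root F a -> a \in S) ->
  henselian divring_sub.
Proof.
move=> [locB henB] rootS; split=> [|F [monF F1 F0]].
  exact: divring_sub_local.
have monF' : map_poly val F \is monic by rewrite monic_map.
have FS : map_poly val F \is a polyOver S.
  by apply/polyOverP=> i; rewrite coef_map; apply: valP.
have [a [ma Fa]] : exists a, henselian_zero (map_poly val F) a.
  apply: henB; split=> //; rewrite coef_map //.
  exact/divring_sub_maximal.
exists (DivringSub (rootS _ _ monF' FS Fa)); split.
  exact/divring_sub_maximal.
by apply/rootP/val_inj; rewrite -horner_map rmorph0; apply/rootP.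
Qed.

Section Corestriction.
Variables (R : nzRingType) (f : {rmorphism R -> B}) (fS : forall r, f r \in S).

Definition divring_corestr r := DivringSub (fS r).

Fact divring_corestr_zmod : zmod_morphism divring_corestr.
Proof. by move=> x y; apply: val_inj; rewrite /= rmorphB. Qed.
HB.instance Definition _ :=
  GRing.isZmodMorphism.Build R divring_sub divring_corestr divring_corestr_zmod.

Fact divring_corestr_monoid : monoid_morphism divring_corestr.
Proof. by split=> [|x y]; apply: val_inj; rewrite /= (rmorph1, rmorphM). Qed.
HB.instance Definition _ :=
  GRing.isMonoidMorphism.Build R divring_sub divring_corestr
    divring_corestr_monoid.

End Corestriction.
End DivringSubType.

(* By the universal property, R^h retracts onto the henselian subring S, and the
   retraction composed with the inclusion is the identity by uniqueness. *)
Lemma henselisation_sub (R Rh : comUnitRingType) (phih : {rmorphism R -> Rh})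
    (S : divringClosed Rh) :
    is_henselisation phih -> (forall r, phih r \in S) ->
    (forall (F : {poly Rh}) a,
      F \is monic -> F \is a polyOver S -> root F a -> a \in S) ->
  forall x, x \in S.
Proof.
move=> [henRh locphi univ] phiS rootS x.
have [g [locg gphi _]] := univ _ (divring_corestr phiS)
  (divring_sub_henselian henRh rootS) locphi.
have [g0 [_ _ g0_uniq]] := univ _ phih henRh locphi.
have id_g0 : idfun =1 g0 by apply: g0_uniq => // r.
have val_g0 : val \o g =1 g0.
  apply: g0_uniq => [y yU | r]; first exact: locg.
  by rewrite /= -[g _]/((g \o phih) r) gphi.
by rewrite -[x]/(idfun x) id_g0 -val_g0; apply: valP.
Qed.

(** * Integrality up to a multiplier in [S] *)

Section ScaledIntegral.
Variables (R B : comNzRingType) (f : {rmorphism R -> B}) (S : mulrClosed R).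

(** Integrality over [S^-1 R] of the image of [z] in [S^-1 B], with denominators cleared. *)
Definition scaled_integral (z : B) :=
  exists2 s, s \in S & integralOver f (f s * z).

Lemma scaled_integral_rmorph r : scaled_integral (f r).
Proof. by exists 1; rewrite ?rpred1 // rmorph1 mul1r; apply: integral_id. Qed.

Lemma scaled_integralB x y :
  scaled_integral x -> scaled_integral y -> scaled_integral (x - y).
Proof.
move=> [s sS sx] [t tS ty]; exists (s * t); first exact: rpredM.
have -> : f (s * t) * (x - y) = f t * (f s * x) - f s * (f t * y).
  by rewrite rmorphM; ring.
by apply: integral_sub; apply: integral_mul => //; apply: integral_id.
Qed.

Lemma scaled_integralM x y :
  scaled_integral x -> scaled_integral y -> scaled_integral (x * y).
Proof.
move=> [s sS sx] [t tS ty]; exists (s * t); first exact: rpredM.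
have -> : f (s * t) * (x * y) = (f s * x) * (f t * y).
  by rewrite rmorphM; ring.
exact: integral_mul.
Qed.

(** The product of the individual multipliers works, because each [f s] is itself integral. *)
Lemma scaled_integral_common (c : seq B) :
    {in c, forall z, scaled_integral z} ->
  exists2 s, s \in S & {in c, forall z, integralOver f (f s * z)}.
Proof.
elim: c => [|z c IHc] intc; first by exists 1; rewrite ?rpred1.
have [|s sS sc] := IHc; first by move=> y cy; apply: intc; rewrite inE cy orbT.
have [t tS tz] := intc z (mem_head _ _).
exists (s * t) => [|y]; first exact: rpredM.
rewrite rmorphM inE => /predU1P[-> | /sc sy].
  by rewrite -mulrA; apply: integral_mul => //; apply: integral_id.
by rewrite mulrAC; apply: integral_mul => //; apply: integral_id.
Qed.

(* If F has degree n and s F_i is integral for all i < n, then s a is a root of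
   the monic polynomial with coefficients s^(n-i) F_i. *)
Lemma scaled_integral_root (F : {poly B}) a :
    F \is monic -> root F a -> {in F : seq B, forall c, scaled_integral c} ->
  scaled_integral a.
Proof.
move=> monF Fa intF; have [s sS sF] := scaled_integral_common intF.
have F_neq0 := monic_neq0 monF.
pose n := (size F).-1; have sizeF : size F = n.+1 by rewrite -polySpred.
pose G := \poly_(i < n.+1) (f s ^+ (n - i) * F`_i).
have Gn : f s ^+ (n - n) * F`_n = 1.
  by rewrite subnn mul1r -[RHS](eqP monF) /lead_coef sizeF.
exists s => //; apply: (@integral_root_monic _ _ f _ G).
- apply/eqP; rewrite /lead_coef size_poly_eq ?Gn ?oner_eq0 //.
  by rewrite coef_poly ltnSn.
- apply/rootP; transitivity (f s ^+ n * F.[a]).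
    rewrite horner_poly horner_coef sizeF mulr_sumr; apply: eq_bigr => i _.
    have <- : f s ^+ (n - i) * f s ^+ i = f s ^+ n.
      by rewrite -exprD subnK // -ltnS.
    by rewrite exprMn; ring.
  by rewrite (rootP Fa) mulr0.
apply/(@integral_poly _ _ f) => i; rewrite coef_poly.
case: ifP => [|_]; last exact: integral0.
rewrite ltnS leq_eqVlt => /predU1P[-> | lt_in]; first
  by rewrite Gn; apply: integral1.
rewrite -(subnSK lt_in) exprSr -mulrA; apply: integral_mul.
  by rewrite -rmorphXn; apply: integral_id.
by apply/sF/mem_nth; rewrite sizeF ltnW.
Qed.

End ScaledIntegral.

(** * Nilpotency up to a multiplier in [S] *)

Section TorsionNilpotent.
Variables (R B : comNzRingType) (f : {rmorphism R -> B}) (S : mulrClosed R).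

(** Nilpotency of the image of [z] in [S^-1 B], with denominators cleared. *)
Definition torsion_nilpotent (z : B) :=
  exists2 s, s \in S & exists N, f s * z ^+ N = 0.

Lemma torsion_nilpotentM x y :
  torsion_nilpotent x -> torsion_nilpotent (x * y).
Proof.
move=> [s sS [N sx]]; exists s => //; exists N.
by rewrite exprMn mulrA sx mul0r.
Qed.

Lemma torsion_nilpotentB x y :
  torsion_nilpotent x -> torsion_nilpotent y -> torsion_nilpotent (x - y).
Proof.
move=> [s sS [N sx]] [t tS [M ty]]; exists (s * t); first exact: rpredM.
exists (N + M)%N; rewrite exprBn mulr_sumr big1 // => i _.
have mul_ty (u v w e : B) : u * f t * (e * v * (w * y ^+ M)) = 0.
  by transitivity (u * v * w * e * (f t * y ^+ M)); [ring | rewrite ty mulr0].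
have mul_sx (u v w e : B) : f s * u * (e * (v * x ^+ N) * w) = 0.
  by transitivity (u * v * w * e * (f s * x ^+ N)); [ring | rewrite sx mulr0].
(* Each binomial term contains [y ^+ M] when [M <= i], and [x ^+ N] otherwise. *)
rewrite rmorphM mulrnAr; case: (leqP M i) => [le_Mi | /ltnW le_iM].
  by rewrite -[X in y ^+ X](subnK le_Mi) exprD mul_ty mul0rn.
have -> : (N + M - i = M - i + N)%N by rewrite addnBAC // [(M + N)%N]addnC.
by rewrite exprD mul_sx mul0rn.
Qed.

End TorsionNilpotent.

(** * Computing with fractions in the localisation *)

Section LocalisationFractions.
Variables (R : comNzRingType) (S : mulrClosed R).
Local Notation loc := (localisation S).

Definition loc_frac (x : fracpair S) : loc := \pi_(loc)%qT x.

Lemma loc_fracP (z : loc) : exists x, z = loc_frac x.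
Proof. by exists (repr z); rewrite /loc_frac reprK. Qed.

Lemma loc_frac_add x y : loc_frac x + loc_frac y = loc_frac (fp_add x y).
Proof. exact/esym/pi_loc_add. Qed.

Lemma loc_frac_mul x y : loc_frac x * loc_frac y = loc_frac (fp_mul x y).
Proof. exact/esym/pi_loc_mul. Qed.

Lemma loc_frac1 : 1 = loc_frac (fp1 S).
Proof. by rewrite /loc_frac piE. Qed.

End LocalisationFractions.

Lemma loc_fracX (R : comNzRingType) (S : mulrClosed R) (x : fracpair S) N :
  exists y : fracpair S,
    [/\ loc_frac x ^+ N = loc_frac y, y.1 = x.1 ^+ N & y.2 = x.2 ^+ N].
Proof.
elim: N => [|N [y [xN y1 y2]]].
  by exists (fp1 S); rewrite expr0 loc_frac1.
by exists (fp_mul x y); rewrite !exprS xN loc_frac_mul /= y1 y2.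
Qed.

Lemma loc_frac0P (R : comNzRingType) (S : mulrClosed R) (x : fracpair S) :
  loc_frac x = 0 <-> exists2 u, u \in S & u * x.1 = 0.
Proof.
have -> : (0 : localisation S) = loc_frac (fp0 S) by rewrite /loc_frac piE.
split=> [/eqP/loc_eqP[u uS] | [u uS ux]].
  by rewrite /= mulr1 mul0r subr0 => ux; exists u.
by apply/eqP/loc_eqP; exists u; rewrite //= mulr1 mul0r subr0.
Qed.

(** * Minimal primes, and polynomials with a coefficient outside [p] *)

Section MinimalPrime.
Variables (R : comNzRingType) (p : prime_idealr R).

Lemma minimal_primeP :
  minimal_prime p <->
  {in p, forall x, torsion_nilpotent idfun (prime_compl p) x}.
Proof.
split=> [minp x px | nilp z].
  pose x1 : fracpair (prime_compl p) :=
    @FracPair _ (prime_compl p) (x, 1) (rpred1 (prime_compl p)).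
  have [z [N]] := minp (loc_frac x1).
  have [y ->] := loc_fracP z; have [w [-> w1 _]] := loc_fracX x1 N.
  rewrite loc_frac1 !(loc_frac_mul, loc_frac_add) => /loc_frac0P[u uS] /=.
  rewrite w1 /= !mul1r mulr1 => e.
  (* The second factor is the numerator of [1 + x y]; it is outside [p] because [x] is in [p] and
     the denominator [y.2] is not. *)
  exists (u * (y.2 + x * y.1)); last by exists N; rewrite -[RHS]e /=; ring.
  apply: rpredM => //; apply/negP => pxy; have /negP[] := fp_denP y.
  by rewrite -(addrK (x * y.1) y.2) rpredB // mulrC idealMr.
have [x ->] := loc_fracP z.
have [px|px] := boolP (x.1 \in p).
  have [s sS [N sx]] := nilp _ px; exists 0, N; rewrite mulr0 addr0 mulr1.
  have [w [-> w1 _]] := loc_fracX x N.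
  by apply/loc_frac0P; exists s; rewrite // w1.
(* A numerator outside [p] makes the fraction invertible: its negated inverse and exponent 0 will
   do. *)
pose y : fracpair (prime_compl p) :=
  @FracPair _ (prime_compl p) (- x.2, x.1) px.
exists (loc_frac y), 0; rewrite expr0 mul1r loc_frac1 loc_frac_mul loc_frac_add.
by apply/loc_frac0P; exists 1; rewrite ?rpred1 //=; ring.
Qed.

Lemma low_coef_factor (B : comNzRingType) (f : {rmorphism R -> B})
    (F : {poly R}) (z : B) k n :
    {in p, forall x, torsion_nilpotent f (prime_compl p) (f x)} ->
    F`_k \notin p ->
    torsion_nilpotent f (prime_compl p) (z ^+ n * (map_poly f F).[z]) ->
  exists2 G : {poly R}, G`_0 \notin p &
    exists m, torsion_nilpotent f (prime_compl p) (z ^+ m * (map_poly f G).[z]).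
Proof.
move=> nilp; elim: k n F => [|k IHk] n.
  by move=> F F0; exists F => //; exists n.
elim/poly_ind => [|F c _]; first by rewrite coef0 idealr0.
rewrite coefD coefMX coefC addr0 => Fk nilF.
have [pc|pc] := boolP (c \in p); last first.
  by exists (F * 'X + c%:P); [rewrite coefD coefMX coefC add0r | exists n].
apply: (IHk n.+1) Fk _.
have -> : z ^+ n.+1 * (map_poly f F).[z] =
    z ^+ n * (map_poly f (F * 'X + c%:P)).[z] - f c * z ^+ n.
  by rewrite rmorphD rmorphM /= map_polyX map_polyC !hornerE exprS; ring.
by apply: torsion_nilpotentB => //; apply/torsion_nilpotentM/nilp.
Qed.
End MinimalPrime.

(* If K x = 0 with K = sum_i K_i X^i, then y = K_0 / x satisfies
   y^n + sum_(i >= 1) K_i K_0^(i-1) y^(n-i) = 0 for any n > deg K. *)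
Lemma integral_const_coefV (R : comNzRingType) (B : comUnitRingType)
    (f : {rmorphism R -> B}) (K : {poly R}) x :
    x \is a GRing.unit -> root (map_poly f K) x ->
  integralOver f (f K`_0 / x).
Proof.
move=> xU /rootP Kx; pose c := K`_0; pose n := size K.
pose L := \poly_(j < n.+1) (K`_(n.+1 - j) * c ^+ (n - j)).
have sizeL : (size L < size ('X^(n.+1) : {poly R})%R)%N.
  by rewrite size_polyXn ltnS size_poly.
exists ('X^(n.+1) + L); first by rewrite monicE lead_coefDl ?lead_coefXn.
(* Multiplied by the unit [x ^+ n.+1], the value at [f c / x] becomes [f c ^+ n] times the value of
   [K] at [x]. *)
apply/rootP/(mulIr (unitrX n.+1 xU)); rewrite mul0r.
rewrite rmorphD /= map_polyXn hornerD hornerXn.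
rewrite (@horner_coef_wide _ n.+1) ?(leq_trans (size_poly _ _)) ?size_poly //.
have {Kx} Kx : f c + \sum_(j < n.+1) f K`_(n.+1 - j) * x ^+ (n.+1 - j) = 0.
  rewrite -[RHS]Kx (@horner_coef_wide _ n.+2); last first.
    by rewrite (leq_trans (size_poly _ _)) // ltnW.
  rewrite [RHS]big_ord_recl coef_map expr0 mulr1; congr (_ + _).
  rewrite (reindex_inj rev_ord_inj) /=; apply: eq_bigr => j _.
  by rewrite coef_map subKn // /bump leq0n add1n subSS.
transitivity (f c ^+ n *
  (f c + \sum_(j < n.+1) f K`_(n.+1 - j) * x ^+ (n.+1 - j)));
  last by rewrite Kx mulr0.
rewrite mulrDl mulrDr exprMn exprVn mulrVK ?unitrX // exprSr; congr (_ + _).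
rewrite mulr_suml mulr_sumr; apply: eq_bigr => j _.
rewrite coef_map coef_poly ltn_ord /= rmorphM rmorphXn exprMn exprVn.
have le_jn : (j <= n)%N by rewrite -ltnS.
have -> : f c ^+ n = f c ^+ (n - j) * f c ^+ j by rewrite -exprD subnK.
have -> : x ^+ n.+1 = x ^+ (n.+1 - j) * x ^+ j by rewrite -exprD subnK // ltnW.
rewrite -!mulrA mulrCA; congr (_ * _); rewrite mulrCA; do 2!congr (_ * _).
by rewrite [x ^+ (_ - _) * _]mulrC mulKr ?unitrX.
Qed.

(** * Stability of scaled integrality under inverses of units *)

Section ScaledIntegralUnit.
Variables (R : comNzRingType) (p : prime_idealr R) (B : comUnitRingType).
Variable f : {rmorphism R -> B}.
Hypothesis nilp :
  {in p, forall x, torsion_nilpotent f (prime_compl p) (f x)}.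

(** If [F] is monic of degree [d] and vanishes at [s x], then [F(s X)] vanishes at [x] and has
    leading coefficient [s^d], which is outside [p]. *)
Lemma scaled_integral_low_coef x :
    scaled_integral f (prime_compl p) x ->
  exists2 G : {poly R}, G`_0 \notin p &
    exists m, torsion_nilpotent f (prime_compl p) (x ^+ m * (map_poly f G).[x]).
Proof.
move=> [s sS [F monF /rootP Fsx]].
pose H := \poly_(i < size F) (F`_i * s ^+ i).
apply: (@low_coef_factor _ _ _ f H x (size F).-1 0%N) => //.
  have F_gt0 : (0 < size F)%N by rewrite size_poly_gt0 monic_neq0.
  rewrite coef_poly prednK // leqnn -/(lead_coef F) (eqP monF) mul1r.
  exact: (@rpredX _ (prime_compl p)).
exists 1; first exact: rpred1.
exists 1%N; rewrite rmorph1 !mul1r expr1 -[RHS]Fsx.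
rewrite !(@horner_coef_wide _ (size F)) ?(leq_trans (size_poly _ _)) //;
  rewrite ?size_poly //.
apply: eq_bigr => i _.
by rewrite !coef_map coef_poly ltn_ord /= rmorphM rmorphXn exprMn mulrA.
Qed.

(** Cancelling the power of the unit [x] makes [t G^N] vanish at [x]; its constant coefficient is
    outside [p] and serves as multiplier for [x^-1]. *)
Lemma scaled_integralV x :
    x \is a GRing.unit -> scaled_integral f (prime_compl p) x ->
  scaled_integral f (prime_compl p) x^-1.
Proof.
move=> xU /scaled_integral_low_coef[G G0 [m [t tS [N tG]]]].
exists (t%:P * G ^+ N)`_0.
  rewrite coefCM; apply: rpredM => //.
  rewrite -horner_coef0 horner_exp horner_coef0.
  exact: (@rpredX _ (prime_compl p)).
apply: integral_const_coefV => //; apply/rootP.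
apply: (mulIr (unitrX (m * N) xU)); rewrite mul0r -[RHS]tG exprMn -exprM.
by rewrite rmorphM rmorphXn /= map_polyC hornerM hornerC horner_exp; ring.
Qed.

Definition scaled_integral_pred : {pred B} :=
  [pred x | `[< scaled_integral f (prime_compl p) x >]].

Fact scaled_integral_divring_closed : divring_closed scaled_integral_pred.
Proof.
split=> [|x y|x y]; rewrite !inE.
- by apply/asboolP; rewrite -(rmorph1 f); apply: scaled_integral_rmorph.
- by move=> /asboolP ix /asboolP iy; apply/asboolP/scaled_integralB.
move=> /asboolP ix /asboolP iy; apply/asboolP/scaled_integralM => //.
(* By convention [y^-1 = y] for a non-unit [y]. *)
have [yU|/invr_out->//] := boolP (y \is a GRing.unit).
exact: scaled_integralV.
Qed.
End ScaledIntegralUnit.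

Lemma henselisation_scaled_integral (R Rh : comUnitRingType)
    (phih : {rmorphism R -> Rh}) (p : prime_idealr R) :
    is_henselisation phih ->
    {in p, forall x, torsion_nilpotent phih (prime_compl p) (phih x)} ->
  forall x, scaled_integral phih (prime_compl p) x.
Proof.
move=> hens nilp.
pose closed := scaled_integral_divring_closed nilp.
pose S : divringClosed Rh := HB.pack (scaled_integral_pred p phih)
  (GRing.isDivringClosed.Build Rh _ closed).
suff inS x : x \in S by move=> x; apply/asboolP; apply: inS.
apply: (henselisation_sub hens) => [r | F a monF /polyOverP FS Fa].
  exact/asboolP/scaled_integral_rmorph.
apply/asboolP/(scaled_integral_root monF Fa) => c /(nthP 0)[i _ <-].
by apply/asboolP; apply: FS.
Qed.

Theorem theorem2 (R : comUnitRingType) (V : idomainType)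
  (phi : {rmorphism R -> V})
  (Rh : comUnitRingType) (phih : {rmorphism R -> Rh})
  (KH : fieldType) (VH : idomainType) (iH : {rmorphism VH -> KH})
  (phiH : {rmorphism {fraction V} -> KH})
  (psi : {rmorphism Rh -> VH}) :
  local_ring R ->
  valuation_domain V ->
  local_morphism phi ->
  minimal_prime (rker phi) ->
  is_henselisation phih ->
  is_val_henselisation (@FracField.tofrac V) iH phiH ->
  local_morphism psi ->
  (forall r : R, iH (psi (phih r)) = phiH (FracField.tofrac (phi r))) ->
  minimal_prime (rker psi).
Proof.
move=> _ _ _ /minimal_primeP nilp hens [[iH_inj _] _ _ _] _ comm.
(* The preimage of [ker psi] is [ker phi] because [iH], [phiH] and the embedding of [V] in its
   fraction field are injective. *)
have psi_phih r : (psi (phih r) == 0) = (phi r == 0).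
  by rewrite -(inj_eq iH_inj) comm rmorph0 fmorph_eq0 tofrac_eq0.
have nilph : {in rker phi, forall x,
    torsion_nilpotent phih (prime_compl (rker phi)) (phih x)}.
  move=> x /nilp[s sS [N sx]]; exists s => //; exists N.
  by rewrite -rmorphXn -rmorphM sx rmorph0.
apply/minimal_primeP => x; rewrite inE => /eqP psix.
have [G G0 [m [t tS [N tG]]]] :=
  scaled_integral_low_coef nilph (henselisation_scaled_integral hens nilph x).
exists (phih t * (map_poly phih G).[x] ^+ N); last first.
  by exists (m * N)%N; rewrite -[RHS]tG exprMn -exprM /=; ring.
rewrite !inE rmorphM rmorphXn mulf_eq0 negb_or psi_phih.
apply/andP; split; [exact: tS | apply: expf_neq0].
(* As [psi x = 0], applying [psi] to [G(x)] leaves only the image of the constant coefficient. *)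
rewrite -horner_map psix horner_coef0 !coef_map /= psi_phih.
exact: G0.
Qed.
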